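(* Let $p>2$ be a prime and let $n\ge 1$ be an integer. Suppose that $A\subset\mathbb{F}_p^n$ does not contain $p$ distinct elements $x_1,\dots,x_p$ such that $x_1+\cdots+x_p=0$. Then $$|A|\leq (2^p-p-2)\,(pJ(p))^n .$$ Moreover, $$\mathfrak{s}\left(\mathbb{F}_p^n\right)\leq (p-1)\,2^p\,(pJ(p))^n .$$
   Context: For a finite abelian group $G$, $\exp(G)$ denotes its exponent (the maximal order of an element of $G$). The Erd\H{o}s-Ginzburg-Ziv constant $\mathfrak{s}(G)$ is the smallest $k\in\mathbb{N}$ such that any sequence of $k$ elements of $G$ (repetitions allowed) contains a subsequence of length $\exp(G)$ whose sum is $0$. For $G=\mathbb{F}_p^n$ with $n\ge 1$, $\exp(G)=p$. The constant $J(p)$ is $$J(p)=\frac{1}{p}\min_{0<x<1}\frac{1-x^{p}}{1-x}\,x^{-\frac{p-1}{3}} .$$ *)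

(* Defs.v *)
From HB Require Import structures.
From mathcomp Require Import all_boot all_order all_algebra.
From mathcomp Require Import all_fingroup all_solvable.
From mathcomp Require Import all_classical all_reals all_analysis.
From mathcomp Require Import ring lra.

Set Implicit Arguments.
Unset Strict Implicit.
Unset Printing Implicit Defensive.

Import Order.TTheory GRing.Theory Num.Theory.
Import numFieldNormedType.Exports.

Local Open Scope ring_scope.

(* The library's [exponent] is defined with lcm's; in an abelian group this is
   the maximal order of an element. *)
Lemma exponent_bigmax (G : finZmodType) :
  exponent [set: G] = (\max_(x : G) #[x]%g)%N.
Proof.
have [|x _ Ex] := @exponent_witness _ [group of [set: G]].
  exact/abelian_nil/FinRing.zmod_abelian.
apply/eqP; rewrite eqn_leq {1}Ex (leq_bigmax x) /=.
by apply/bigmax_leqP => y _; rewrite dvdn_leq ?exponent_gt0 ?dvdn_exponent ?inE.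
Qed.

Definition has_zero_sum_subseq (G : finZmodType) (k : nat) : bool :=
  [forall s : k.-tuple G, [exists t : (exponent [set: G]).-tuple G,
     subseq t s && (\sum_(x <- t) x == 0)]].

Lemma ex_zero_sum_subseq (G : finZmodType) :
  exists k, has_zero_sum_subseq G k.
Proof.
set e := exponent [set: G].
have e_gt0 : (0 < e)%N by rewrite exponent_gt0.
exists (#|G| * e)%N; apply/forallP => s.
have [g le_eg] : exists g : G, (e <= count_mem g s)%N.
  apply/existsP; apply: contraT => /existsPn lt_e.
  have: (\sum_(g : G) count_mem g s < \sum_(g : G) e)%N.
    rewrite (bigD1 0) //= [ltnRHS](bigD1 0) //= -addSn leq_add //.
      by rewrite ltnNge lt_e.
    by apply: leq_sum => g _; rewrite ltnW // ltnNge lt_e.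
  suff -> : (\sum_(g : G) count_mem g s)%N = size s.
    by rewrite size_tuple sum_nat_const ltnn.
  rewrite -sum1_size [RHS](partition_big id predT) //=.
  by apply: eq_bigr => g _; rewrite -sum1_count.
apply/existsP; exists (nseq_tuple e g); apply/andP; split.
  apply: (@subseq_trans _ (nseq (count_mem g s) g)); last first.
    have <- : seq.filter (pred1 g) s = nseq (count_mem g s) g.
      by rewrite -size_filter; apply/all_pred1P/filter_all.
    exact: filter_subseq.
  by rewrite -(subnKC le_eg) nseqD prefix_subseq.
rewrite /= big_nseq iter_addr_0.
by have := expg_exponent (finset.in_setT g); rewrite FinRing.zmodXgE => ->.
Qed.

Definition erdos_ginzburg_ziv (G : finZmodType) : nat :=
  ex_minn (ex_zero_sum_subseq G).

Definition Jfun (R : realType) (p : nat) (x : R) : R :=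
  (1 - x ^+ p) / (1 - x) * x `^ (- ((p%:R - 1) / 3)).

(* The minimum is written as an infimum; for 2 < p it is attained, by
   [Jfun_min] and [JE]. *)
Definition J (R : realType) (p : nat) : R :=
  p%:R^-1 * inf (@Jfun R p @` `]0, 1[).

Lemma geometric_lt (R : realType) (p : nat) : (2 < p)%N ->
  exists2 z : R, 0 < z < 1 & \sum_(i < p) z ^+ (3 * i) < p%:R * z ^+ p.-1.
Proof.
move=> p2.
pose Q : {poly R} := p%:R *: 'X^(p.-1) - \sum_(i < p) 'X^(3 * i).
have hQ z : Q.[z] = p%:R * z ^+ p.-1 - \sum_(i < p) z ^+ (3 * i).
  rewrite !hornerE horner_sum; congr (_ - _).
  by apply: eq_bigr => i _; rewrite !hornerE.
have /factor_theorem[S QE] : root Q 1.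
  rewrite /root hQ expr1n mulr1 (eq_bigr (fun=> 1)) => [|i _].
    by rewrite sumr_const card_ord subrr.
  by rewrite expr1n.
have S1 : S.[1] < 0.
  have <- : Q^`().[1] = S.[1].
    by rewrite QE derivM derivXsubC mulr1 !hornerE subrr mulr0 add0r.
  have gauss m : 2 * \sum_(i < m) (3 * i)%:R = 3 * (m%:R * (m%:R - 1)) :> R.
    elim: m => [|m IH]; first by rewrite big_ord0; ring.
    by rewrite big_ord_recr /= mulrDr IH; rewrite natrM -natr1; ring.
  have -> : Q^`().[1] = p%:R * (p%:R - 1) - \sum_(i < p) (3 * i)%:R.
    rewrite derivB derivZ derivXn (raddf_sum (@deriv R)) !hornerE horner_sum.
    have dX (i : nat) : ('X^(3 * i) : {poly R})^`().[1] = (3 * i)%:R.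
      by rewrite derivXn hornerMn hornerXn expr1n.
    rewrite (eq_bigr (fun i : 'I_p => (3 * i)%:R)) => [|i _]; last exact: dX.
    rewrite hornerMn hornerXn expr1n -[p in p%:R - 1]prednK ?(ltn_trans _ p2) //.
    by rewrite -natr1 addrK.
  have := gauss p; have : (2 : R) < p%:R by rewrite ltr_nat.
  nra.
have cS : (S.[z] @[z --> 1^'-] --> S.[1])%classic.
  exact/cvg_at_left_filter/continuous_horner.
near ((1 : R)^'-)%classic => z; exists z; first by apply/andP; split; near: z;
  [exact: nbhs_left_gt|exact: nbhs_left_lt].
have z1 : z < 1 by near: z; exact: nbhs_left_lt.
have Sz : S.[z] < 0 by near: z; exact: cvgr_lt cS _ S1.
rewrite -subr_gt0 -hQ QE hornerM hornerXsubC; nra.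
Unshelve. all: by end_near. Qed.

Lemma Jfun_min (R : realType) (p : nat) : (2 < p)%N ->
  exists2 c : R, c \in `]0, 1[ &
    forall x : R, x \in `]0, 1[ -> Jfun p c <= Jfun p x.
Proof.
move=> p2; pose a : R := (p%:R - 1) / 3.
have p_gt2 : (2 : R) < p%:R by rewrite ltr_nat.
pose P : {poly R} := \sum_(i < p) 'X^i.
have hP x : P.[x] = \sum_(i < p) x ^+ i.
  by rewrite horner_sum; apply: eq_bigr => i _; rewrite hornerXn.
pose F (x : R) := P.[x] * x `^ (- a).
have JF x : x \in `]0, 1[ -> Jfun p x = F x.
  rewrite in_itv /= => /andP[_ x1]; rewrite /F hP; congr (_ * _).
  rewrite -opprB subrX1 -mulNr opprB mulrAC divff ?mul1r //.
  by rewrite subr_eq0 gt_eqF.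
have F1 : F 1 = p%:R.
  rewrite /F powR1 mulr1 hP (eq_bigr (fun=> 1)) => [|i _].
    by rewrite sumr_const card_ord.
  by rewrite expr1n.
have [y y01 Fy] : exists2 y, y \in `]0, 1[ & F y < p%:R.
  have [z /andP[z0 z1] lt_z] := geometric_lt R p2.
  exists (z ^+ 3); first by rewrite in_itv /= exprn_gt0 ?exprn_ilt1 // ltW.
  have -> : F (z ^+ 3) = (\sum_(i < p) z ^+ (3 * i)) / z ^+ p.-1.
    rewrite /F hP; congr (_ * _); first by apply: eq_bigr => i _; rewrite exprM.
    rewrite powRN -(powR_mulrn 3) ?ltW // -powRrM mulrC divfK ?pnatr_eq0 //.
    rewrite -[p in p%:R - 1]prednK ?(ltn_trans _ p2) // -natr1 addrK.
    by rewrite powR_mulrn ?ltW.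
  by rewrite ltr_pdivrMr ?exprn_gt0.
pose d : R := (p%:R ^+ 3)^-1.
have d0 : 0 < d by rewrite invr_gt0 exprn_gt0 //; lra.
have d1 : d <= 1 by rewrite invf_le1 ?exprn_gt0 ?exprn_ege1 //; lra.
have a0 : 0 <= a by rewrite /a; lra.
have Fd x : 0 < x <= d -> p%:R <= F x.
  move=> /andP[x0 xd].
  have P1 : 1 <= P.[x].
    rewrite hP (bigD1 (Ordinal (ltn_trans (isT : 0 < 2)%N p2))) //= expr0.
    by rewrite lerDl sumr_ge0 // => i _; rewrite exprn_ge0 // ltW.
  apply: le_trans (_ : x `^ (- a) <= _); last by rewrite ler_peMl ?powR_ge0.
  apply: le_trans (_ : d `^ (- a) <= _); last first.
    rewrite !powRN lef_pV2 ?posrE ?powR_gt0 //.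
    by apply: ge0_ler_powR => //; rewrite nnegrE ltW.
  rewrite /d -powR_invn ?ler0n // -powRrM mulrNN mulrC divfK ?pnatr_eq0 //.
  by apply: le1r_powR; lra.
have [|c] := @EVT_min R F d 1 d1.
  apply: derivable_within_continuous => x; rewrite in_itv /= => /andP[dx _].
  apply: derivableM; first exact: derivable_horner.
  by apply: derivable_powR; rewrite in_itv /= andbT (lt_le_trans d0 dx).
rewrite in_itv /= => /andP[dc c1] minc.
have Fcy : F c <= F y.
  move: y01; rewrite in_itv /= => /andP[y0 y1].
  apply: minc; rewrite in_itv /= (ltW y1) andbT leNgt; apply/negP => yd.
  by move: Fy; rewrite ltNge Fd // y0 ltW.
have c01 : c \in `]0, 1[.
  rewrite in_itv /= (lt_le_trans d0) //= lt_neqAle c1 andbT.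
  by apply: contraTneq (le_lt_trans Fcy Fy) => ->; rewrite F1 ltxx.
exists c => // x x01; rewrite !JF //.
move: (x01); rewrite in_itv /= => /andP[x0 x1].
have [xd|dx] := leP x d.
  by rewrite (le_trans Fcy) // (le_trans (ltW Fy)) // Fd // x0.
by apply: minc; rewrite in_itv /= !ltW.
Qed.

Lemma JE (R : realType) (p : nat) (c : R) : c \in `]0, 1[ ->
  (forall x : R, x \in `]0, 1[ -> Jfun p c <= Jfun p x) ->
  J R p = p%:R^-1 * Jfun p c.
Proof.
move=> c01 minc; congr (_ * _); apply/eqP; rewrite eq_le; apply/andP; split.
  by apply: ge_inf; [exists (Jfun p c) => _ [x x01 <-]; exact: minc|exists c].
apply: lb_le_inf; first by exists (Jfun p c), c.
by move=> _ [x x01 <-]; exact: minc.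
Qed.

(* Main.v *)
Require Import Defs.
From HB Require Import structures.
From mathcomp Require Import all_classical all_reals all_analysis.
From mathcomp Require Import all_boot all_order all_algebra.
From mathcomp Require Import all_fingroup all_solvable all_field.
From mathcomp Require Import lra zify.

(* Let X be the set A. The tensor [x injective] [x_1 + ... + x_p = 0] on X^p
   vanishes. Expand the injectivity indicator as the signed sum, over the
   permutations s, of the indicators [x o s = x]. When s has at most two orbits,
   [x o s = x] [sum x = 0] is the indicator of the diagonal, because a u + b v = 0
   with a + b = p forces u = v; these terms add up to a nonzero multiple of the
   diagonal tensor, whose partition rank is |X|. When s has at least three orbits,
   every monomial of the polynomial prod_i (1 - (sum_j x_ji)^(p-1)) has degree at
   most n(p-1)/3 in the variables of some orbit B. So the diagonal tensor is a sum
   of products f(x_B) g(x_(~B)) indexed by a block B, nonempty and missing at least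
   two indices, and a monomial of degree at most n(p-1)/3. There are 2^p - p - 2
   such blocks, and at most (p J(p))^n such monomials.
   For the Erdos-Ginzburg-Ziv constant, a sequence without p equal terms has at
   least 1/(p-1) times as many distinct terms as its length. *)

Set Implicit Arguments.
Unset Strict Implicit.
Unset Printing Implicit Defensive.

Import Order.TTheory GRing.Theory Num.Theory.
Local Open Scope ring_scope.

(** * Orthogonal vectors with few zeros *)

(** A basis of the left kernel, written as rows, has as many independent columns as rows. Some
    combination of the rows equals 1 on all these columns, so it has at most [\rank M <= m]
    zeros. *)
Lemma kermx_few_zeros (F : fieldType) (N m : nat) (M : 'M[F]_(N, m)) :
  exists2 h : 'rV[F]_N, h *m M = 0 & (#|[set i | h 0%R i == 0%R]| <= m)%N.
Proof.
pose K := row_base (kermx M).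
have fullK : row_full K^T by rewrite /row_full mxrank_tr eq_row_base.
pose f := fullrankfun fullK.
pose u := invmx (rowsub f K^T) *m const_mx 1 : 'cV[F]_(\rank (kermx M)).
exists (K^T *m u)^T.
  apply/sub_kermxP; rewrite trmx_mul trmxK.
  by apply: submx_trans (submxMl _ _) _; rewrite eq_row_base.
have fE i : (K^T *m u)^T 0 (f i) = 1.
  have -> : (K^T *m u)^T 0 (f i) = (rowsub f K^T *m u) i 0.
    by rewrite mul_rowsub_mx !mxE.
  by rewrite mulmxA mulmxV ?fullrowsub_unit // mul1mx mxE.
have zf : [set i | (K^T *m u)^T 0 i == 0] \subset ~: (f @: setT).
  apply/subsetP => i; rewrite inE => /eqP zi; rewrite inE.
  by apply/negP => /imsetP[j _ ij]; move: (oner_neq0 F); rewrite -(fE j) -ij zi eqxx.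
rewrite (leq_trans (subset_leq_card zf)) // cardsCs setCK.
rewrite card_imset; last exact: fullrankfun_inj.
rewrite cardsT !card_ord mxrank_ker subKn ?rank_leq_row //; exact: rank_leq_col.
Qed.

Lemma orthogonal_few_zeros (F : fieldType) (X J : finType) (D : {set J})
    (f : J -> X -> F) :
  exists2 h : X -> F, {in D, forall t, \sum_a h a * f t a = 0}
    & (#|[set a | h a == 0%R]| <= #|D|)%N.
Proof.
have [h hM zh] := kermx_few_zeros
  (\matrix_(i < #|X|, t < #|D|) f (enum_val t) (enum_val i)).
exists (fun a => h 0 (enum_rank a)) => [t tD|].
  have := congr1 (fun A : 'rV_#|D| => A 0 (enum_rank_in tD t)) hM.
  rewrite !mxE => hs; rewrite -[RHS]hs [RHS](reindex (@enum_rank X)) /=.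
    by apply: eq_bigr => a _; rewrite mxE enum_rankK enum_rankK_in.
  by apply: onW_bij; exact: enum_rank_bij.
rewrite (leq_trans _ zh) // -(card_imset _ (@enum_rank_inj X)) subset_leq_card //.
by apply/subsetP => _ /imsetP[a az ->]; rewrite !inE in az *.
Qed.

(** * Partition rank of a diagonal tensor: contraction of variables *)

Definition depends_on (I X : finType) (F : Type) (B : {set I})
    (f : {ffun I -> X} -> F) :=
  forall x y : {ffun I -> X}, {in B, forall i, x i = y i} -> f x = f y.

Definition upd (I X : finType) (s : I) (a : X) (x : {ffun I -> X}) :=
  [ffun i => if i == s then a else x i].

(* The variables of S are contracted one at a time, each against a vector h
   orthogonal to the factors that depend on this variable only: a contraction
   kills at least as many terms as it creates zeros on the diagonal. *)
Lemma partition_rank_diag_rooted (F : fieldType) (I X J : finType) (i0 : I)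
    (D : {set J}) (S : {set I}) (B : J -> {set I})
    (f g : J -> {ffun I -> X} -> F) (c : X -> F) :
  i0 \notin S ->
  {in D, forall t, B t \subset S /\ B t != set0} ->
  {in D, forall t, depends_on (B t) (f t)} ->
  {in D, forall t, depends_on (~: B t) (g t)} ->
  (forall x, \sum_(t in D) f t x * g t x
             = c (x i0) *+ [forall i in S, x i == x i0]) ->
  (#|[set a | c a != 0%R]| <= #|D|)%N.
Proof.
elim: {S}#|S| {-2}S (erefl #|S|) => [|k IH] S cS in D B f g c *.
  move=> _ BS _ _ E.
  have D0 : D = set0.
    apply/setP => t; rewrite inE; apply/negP => /BS[].
    by rewrite (cards0_eq cS) subset0 => ->.
  rewrite D0 cards0 leqn0 cards_eq0; apply/eqP/setP => a; rewrite !inE.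
  (* With no variable left there is no block: the sum is empty, and [E] at a constant point gives
     [c a = 0]. *)
  apply/negbTE; rewrite negbK; have := E [ffun=> a].
  rewrite D0 big_set0 (cards0_eq cS) ffunE (_ : [forall _ in _, _]) ?mulr1n => [<- //|].
  by apply/forall_inP => i; rewrite inE.
move=> i0S BS df dg E.
have /card_gt0P[s sS] : (0 < #|S|)%N by rewrite cS.
have si0 : i0 != s by apply: contraNneq i0S => ->.
(* The terms of [D0] have a factor in the variable [s] alone; [h] is orthogonal to all these
   factors. *)
pose D0 := [set t in D | B t == [set s]].
have [h hD0 zh] := orthogonal_few_zeros D0 (fun t a => f t [ffun=> a]).
(* Summing against [h] over the value at [s] affects one factor of each product, the only one that
   may depend on [s]. *)
pose f' t x := if s \in B t then \sum_a h a * f t (upd s a x) else f t x.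
pose g' t x := if s \in B t then g t x else \sum_a h a * g t (upd s a x).
have fgE t x : t \in D ->
    \sum_a h a * (f t (upd s a x) * g t (upd s a x)) = f' t x * g' t x.
  move=> tD; rewrite /f' /g'; case: ifPn => sB.
    rewrite mulr_suml; apply: eq_bigr => a _; rewrite mulrA; congr (_ * _).
    apply: dg => // i; rewrite inE => iB; rewrite ffunE.
    by case: eqP => // is_; rewrite is_ sB in iB.
  rewrite mulr_sumr; apply: eq_bigr => a _; rewrite mulrCA; congr (_ * _).
  apply: df => // i iB; rewrite ffunE.
  by case: eqP => // is_; rewrite -is_ iB in sB.
have upd_dep a (x y : {ffun I -> X}) (C : {set I}) : {in C :\ s, forall i, x i = y i} ->
    {in C, forall i, upd s a x i = upd s a y i}.
  by move=> xy i iC; rewrite !ffunE; case: eqP => // /eqP is_; rewrite xy // !inE is_.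
have D0D : D0 \subset D by apply/subsetP => t; rewrite inE => /andP[].
have : (#|[set a | (h a * c a)%R != 0%R]| <= #|D :\: D0|)%N.
  apply: (IH (S :\ s) _ (D :\: D0) (fun t => B t :\ s) f' g').
  - by have := cardsD1 s S; rewrite sS cS add1n => -[].
  - by rewrite !inE negb_and i0S orbT.
  - move=> t /setDP[tD]; rewrite inE tD /= => Bts.
    have [BtS Bt0] := BS t tD; split; first exact: setSD.
    apply: contraNneq Bts => B0; rewrite eqEsubset -setD_eq0 B0 eqxx /=.
    by move: Bt0; rewrite -!card_gt0 sub1set (cardsD1 s) B0 cards0 addn0 lt0b.
  - move=> t /setDP[tD _] x y xy; rewrite /f'; case: ifPn => sB.
      by apply: eq_bigr => a _; congr (_ * _); apply: df => //; exact: upd_dep.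
    apply: df => // i iB; apply: xy; rewrite !inE iB andbT.
    by apply: contraNneq sB => <-.
  - move=> t /setDP[tD _] x y xy; rewrite /g'; case: ifPn => sB.
      by apply: dg => // i; rewrite inE => iB; apply: xy; rewrite !inE (negbTE iB) andbF.
    apply: eq_bigr => a _; congr (_ * _); apply: dg => //; apply: upd_dep => // i.
    by rewrite !inE => /andP[is_ iB]; apply: xy; rewrite !inE is_.
  move=> x.
  have <- : \sum_a h a * \sum_(t in D) f t (upd s a x) * g t (upd s a x) =
       (h (x i0) * c (x i0)) *+ [forall i in S :\ s, x i == x i0].
    under eq_bigr do rewrite E ffunE (negbTE si0).
    rewrite (bigD1 (x i0)) //= [X in _ + X]big1 ?addr0 => [|a ax].
      rewrite -mulrnAr; congr (_ * (_ *+ nat_of_bool _)).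
      apply/forall_inP/forall_inP => H i.
        rewrite !inE => /andP[is_ iS]; have := H i iS.
        by rewrite !ffunE (negbTE is_).
      move=> iS; rewrite !ffunE; case: ifPn => [_|is_]; first exact: eqxx.
      by apply: H; rewrite !inE is_.
    rewrite (_ : [forall _ in _, _] = false) ?mulr0 //.
    apply/negbTE/forall_inPn; exists s => //.
    by rewrite !ffunE eqxx.
  transitivity (\sum_(t in D) f' t x * g' t x); last first.
    under [in RHS]eq_bigr do rewrite mulr_sumr.
    rewrite exchange_big; apply: eq_bigr => t tD; by rewrite -fgE.
  rewrite [RHS](big_setID D0) /= (finset.setIidPr D0D).
  rewrite [X in _ = X + _]big1 ?add0r // => t tD0.
  have := tD0; rewrite inE => /andP[tD /eqP Bt].
  rewrite /f' Bt inE eqxx (eq_bigr (fun a => h a * f t [ffun=> a])) ?hD0 ?mul0r //.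
  move=> a _; congr (_ * _); apply: df => // i.
  by rewrite Bt inE => /eqP->; rewrite !ffunE eqxx.
(* A nonzero of [c] is a nonzero of [h * c] or a zero of [h]; the zeros of [h] are at most as many
   as the [#|D0|] terms killed. *)
rewrite cardsDS // => /leq_trans/(_ (leq_sub2l _ zh)).
rewrite leq_subRL; last first.
  exact: leq_trans zh (subset_leq_card D0D).
apply: leq_trans; apply: leq_trans (leq_card_setU _ _).
apply: subset_leq_card; apply/subsetP => a; rewrite !inE mulf_eq0 negb_or => ->.
by rewrite andbT orbN.
Qed.

(** * Signed sums over permutations and their orbits *)

(* The left-hand side is the determinant of the matrix [x i == x j]. *)
Lemma sum_sign_stable (R : comNzRingType) (X : finType) (p : nat) (x : {ffun 'I_p -> X}) :
  \sum_(s : 'S_p) (-1) ^+ s *+ [forall i, x (s i) == x i]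
    = (injectiveb x)%:R :> R.
Proof.
pose M : 'M[R]_p := \matrix_(i, j) (x j == x i)%:R.
have <- : \det M = \sum_(s : 'S_p) (-1) ^+ s *+ [forall i, x (s i) == x i].
  apply: eq_bigr => s _; rewrite -mulr_natr; congr (_ * _).
  under eq_bigr do rewrite mxE.
  case: forallP => [H|/forallP/forallPn[i xi]].
    by rewrite big1 // => i _; rewrite H.
  by rewrite (bigD1 i) //= (negbTE xi) mul0r.
(* Distinct values give the identity matrix; a repeated value gives two equal rows. *)
case: injectiveP => [inj|/injectiveP/injectivePn[i [j ij xij]]].
  rewrite (_ : M = 1%:M) ?det1 //; apply/matrixP => i j.
  by rewrite !mxE (inj_eq inj) eq_sym.
by rewrite (determinant_alternate ij) // => k; rewrite !mxE xij.
Qed.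

Lemma porbits_conj (T : finType) (s c : {perm T}) :
  porbits (s ^ c) = [set c @: B | B : {set T} in porbits s].
Proof.
have E i : porbit (s ^ c) (c i) = c @: porbit s i.
  apply/setP => j; apply/porbitP/imsetP => [[k ->]|[_ /porbitP[k ->] ->]].
    by exists ((s ^+ k)%g i); rewrite ?mem_porbit // -conjXg permJ.
  by exists k; rewrite -conjXg permJ.
apply/setP => B; apply/imsetP/imsetP => [[i _ ->]|[_ /imsetP[i _ ->] ->]].
  by exists (porbit s (c^-1%g i)); rewrite ?imset_f // -E permKV.
by exists (c i); rewrite ?E.
Qed.

Lemma card_porbits_conj (T : finType) (s c : {perm T}) :
  #|porbits (s ^ c)| = #|porbits s|.
Proof. by rewrite porbits_conj card_imset //; apply: imset_inj; exact: perm_inj. Qed.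

(** Translation of Z/(m+1); for [m > 0], [shift 1] is a full cycle whose powers are all the
    translations. *)
Definition shift (m : nat) (a : 'I_m.+1) : 'S_m.+1 := perm (addrI a).

Lemma shiftX (m : nat) (a : 'I_m.+1) k : (shift a ^+ k)%g = shift (a *+ k).
Proof.
apply/permP => i; elim: k => [|k IH]; first by rewrite perm1 permE mulr0n add0r.
by rewrite expgSr permM IH !permE mulrS addrA.
Qed.

Lemma shift_inj (m : nat) : injective (@shift m).
Proof. by move=> a b /permP/(_ 0); rewrite !permE !addr0. Qed.

(** Commutation reads [s (1 + i) = 1 + s i], so [s 0] determines [s]: the centralizer of a full
    cycle consists of its powers. *)
Lemma commute_shift1 (m : nat) (s : 'S_m.+2) :
  commute s (shift 1) -> s = shift (s 0).
Proof.
move=> cs.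
have sS i : s (1 + i) = 1 + s i.
  by have /permP/(_ i) := cs; rewrite !permM ![shift 1 _]permE.
apply/permP => i; rewrite permE -[i]natr_Zp.
elim: (nat_of_ord i) => [|k IH]; first by rewrite addr0.
by rewrite -natr1 addrC sS IH addrCA.
Qed.

Lemma odd_permX (T : finType) (s : {perm T}) k :
  odd_perm (s ^+ k)%g = odd k && odd_perm s.
Proof.
elim: k => [|k IH]; first by rewrite odd_perm1.
by rewrite expgS odd_permM IH /=; case: odd; case: odd_perm.
Qed.

Lemma porbits1 (T : finType) : #|porbits (1 : {perm T})%g| = #|T|.
Proof.
have E (i : T) : porbit 1 i = [set i].
  apply/setP => j; rewrite inE; apply/porbitP/eqP => [[k ->]|->].
    by rewrite expg1n perm1.
  by exists 0; rewrite perm1.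
by rewrite card_imset // => i j; rewrite !E => /finset.set1_inj.
Qed.

Lemma porbits_shift1 (m : nat) : #|porbits (shift (1 : 'I_m.+2))| = 1%N.
Proof.
have E (i : 'I_m.+2) : porbit (shift 1) i = porbit (shift 1) 0.
  apply/eqP; rewrite eq_porbit_mem; apply/porbitP; exists i.
  by rewrite shiftX permE addr0 natr_Zp.
apply/eqP/cards1P; exists (porbit (shift 1) (0 : 'I_m.+2)).
by apply/setP => B; rewrite inE; apply/imsetP/eqP => [[i _ ->]|->]; [exact: E|exists 0].
Qed.

(* Conjugation by a full cycle has no fixed point among the permutations with
   at most two orbits, except its own nontrivial powers, which are even: so the
   sum is -1 modulo [p]. *)
Lemma sum_sign_few_porbits_neq0 (p : nat) : prime p -> (2 < p)%N ->
  \sum_(s : 'S_p | (#|porbits s| <= 2)%N) (-1) ^+ s != 0 :> 'F_p.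
Proof.
case: p => [|[|m]] // p_pr p_gt2.
set p := m.+2 in p_pr p_gt2 *.
have p_odd : odd p by case: (even_prime p_pr) => // p2; rewrite p2 in p_gt2.
pose c : 'S_p := shift 1.
have shift0 : shift (0 : 'I_p) = 1%g.
  by apply/permP => i; rewrite permE perm1 add0r.
have shift_p (a : 'I_p) : (shift a ^+ p)%g = 1%g.
  by rewrite shiftX -mulr_natr (@pchar_Zp p) // mulr0 shift0.
have oc : #[c]%g = p.
  apply: nt_prime_order => //; first exact: shift_p.
  by apply/eqP; rewrite -shift0 => /shift_inj/eqP; rewrite oner_eq0.
have even_shift (a : 'I_p) : odd_perm (shift a) = false.
  have := odd_permX (shift a) p; rewrite shift_p odd_perm1 p_odd; by case: odd_perm.
have pc : (p.-group <[c]>)%g by rewrite /pgroup -orderE oc pnat_id.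
pose few b := [set s : 'S_p | (#|porbits s| <= 2)%N & odd_perm s == b].
have fixE b : #|few b| = #|'Fix_(few b | conjg_action _)(<[c]>)%g| %[mod p].
  apply: pgroup_fix_mod => //; apply/actsP => d _ s.
  by rewrite !inE card_porbits_conj odd_permJ.
have fix_shift b s : s \in 'Fix_(few b | conjg_action _)(<[c]>)%g -> s = shift (s 0).
  by rewrite afixJ cent_cycle => /setIP[_ /cent1P]; exact: commute_shift1.
have dvd_odd : (p %| #|few true|)%N.
  rewrite /dvdn fixE (_ : _ :&: _ = finset.set0) ?cards0 //.
  apply/setP => s; rewrite [RHS]inE; apply/negP => sF.
  have := sF; rewrite (fix_shift _ _ sF) => /setIP[].
  by rewrite inE even_shift andbF.
(* The fixed points are shifts; they include [c] and exclude the identity, which has [p > 2] orbits.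
   Their number is thus between 1 and [p - 1]. *)
have dvd_even : ~~ (p %| #|few false|)%N.
  rewrite /dvdn fixE; apply: contraTN p_pr => /eqP mod0; exfalso; move: mod0.
  rewrite modn_small => [/eqP|].
    rewrite cards_eq0 => /eqP/setP/(_ c); rewrite inE [RHS]inE afixJ cent_cycle.
    by rewrite inE porbits_shift1 even_shift cent1id.
  apply: (@leq_ltn_trans #|@shift m.+1 @: [set~ 0%R]|).
    apply/subset_leq_card/subsetP => s sF; apply/imsetP; exists (s 0).
      rewrite !inE; apply: contraTneq sF => s0; apply/negP => sF.
      have := sF; rewrite (fix_shift _ _ sF) s0 shift0 => /setIP[].
      by rewrite inE porbits1 card_ord leqNgt p_gt2.
    exact: fix_shift sF.
  by rewrite card_imset ?cardsC1 ?card_ord //; exact: shift_inj.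
have sum_few b : \sum_(s in few b) (-1) ^+ s = (-1) ^+ b *+ #|few b| :> 'F_p.
  by rewrite -sumr_const; apply: eq_bigr => s; rewrite inE => /andP[_ /eqP->].
rewrite (bigID (@odd_perm _)) /=.
rewrite (eq_bigl (fun s => s \in few true)) => [|s]; last by rewrite !inE eqb_id.
rewrite [X in _ + X](eq_bigl (fun s => s \in few false)) => [|s]; last first.
  by rewrite !inE eqbF_neg.
have cF := pchar_Fp p_pr.
rewrite /= !sum_few -mulr_natr -[X in _ + X]mulr_natr.
move: dvd_odd; rewrite (dvdn_pcharf cF) => /eqP->.
by rewrite mulr0 add0r expr0 mul1r -(dvdn_pcharf cF).
Qed.

Lemma few_porbits_const (p n : nat) (s : 'S_p) (v : 'I_p -> 'rV['F_p]_n) :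
  prime p -> (#|porbits s| <= 2)%N -> (forall i, v (s i) = v i) ->
  \sum_i v i = 0 -> forall i j, v i = v j.
Proof.
move=> p_pr s2 vs v0 i j.
have vo k l : k \in porbit s l -> v k = v l.
  by case/porbitP => m ->; elim: m => [|m <-]; rewrite ?perm1 // expgSr permM vs.
have [ij|ij] := boolP (j \in porbit s i); first by rewrite (vo _ _ ij).
pose a := #|porbit s i|.
(* An index [k] outside the orbits of [i] and [j] would give a third orbit. *)
have vE k : v k = if k \in porbit s i then v i else v j.
  case: ifPn => [/vo //|ki]; apply: vo; apply: contraTT s2 => kj.
  rewrite -ltnNge.
  apply: (@leq_trans #|porbit s i |: [set porbit s j; porbit s k]|).
    rewrite cardsU1 cards2 !inE !eq_porbit_mem ![_ \in porbit s k]porbit_sym.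
    by rewrite [i \in porbit s j]porbit_sym (negbTE ij) (negbTE ki) (negbTE kj).
  apply/subset_leq_card/subsetP => B; rewrite !inE.
  by case/or3P => /eqP->; rewrite imset_f.
(* In characteristic [p] the zero sum reduces to this multiple of [v i - v j], and [0 < a < p]. *)
have : (v i - v j) *+ a = 0.
  have sv : \sum_k (v j + (v i - v j) *+ (k \in porbit s i)) = 0.
    rewrite -[RHS]v0; apply: eq_bigr => k _; rewrite [RHS]vE.
    by case: ifP; rewrite ?addr0 // addrC subrK.
  rewrite -sv big_split /= sumr_const card_ord -[v j *+ p]scaler_nat.
  rewrite (pcharf0 (pchar_Fp p_pr)) scale0r add0r sumrMnr /a -sum1_card big_mkcond.
  by congr (_ *+ _); apply: eq_bigr => k _; case: ifP.
rewrite -scaler_nat => /eqP; rewrite scaler_eq0 subr_eq0 => /orP[|/eqP//].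
rewrite -(dvdn_pcharf (pchar_Fp p_pr)) gtnNdvd //.
  by rewrite card_gt0; apply/finset.set0Pn; exists i; exact: porbit_id.
rewrite -[X in (_ < X)%N]card_ord; apply/proper_card/properP; split.
  exact/subsetP.
by exists j.
Qed.

(** * Partition rank of the full diagonal *)

(** In each product the roles of [f] and [g] are exchanged if necessary, so that the block avoids
    the root [i0]. *)
Lemma partition_rank_diag (F : fieldType) (I X J : finType) (i0 : I)
    (D : {set J}) (B : J -> {set I}) (f g : J -> {ffun I -> X} -> F) (c : X -> F) :
  {in D, forall t, B t != set0 /\ ~: B t != set0} ->
  {in D, forall t, depends_on (B t) (f t)} ->
  {in D, forall t, depends_on (~: B t) (g t)} ->
  (forall x, \sum_(t in D) f t x * g t x
             = c (x i0) *+ [forall i, x i == x i0]) ->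
  (#|[set a | c a != 0%R]| <= #|D|)%N.
Proof.
move=> BT df dg E.
apply: (partition_rank_diag_rooted (i0 := i0) (S := [set~ i0])
  (B := fun t => if i0 \in B t then ~: B t else B t)
  (f := fun t => if i0 \in B t then g t else f t)
  (g := fun t => if i0 \in B t then f t else g t)).
- by rewrite !inE eqxx.
- move=> t /BT[B0 BT']; case: ifPn => iB; split=> //.
    by rewrite setCS sub1set.
  by rewrite subsetC sub1set inE.
- by move=> t tD; case: ifP => _; [exact: dg|exact: df].
- by move=> t tD; case: ifP => _; [rewrite setCK; exact: df|exact: dg].
move=> x; rewrite [RHS](_ : _ = c (x i0) *+ [forall i, x i == x i0]).
  rewrite -E; apply: eq_bigr => t _; by case: ifP => //; rewrite mulrC.
congr (_ *+ nat_of_bool _); apply/forall_inP/forallP => H i.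
  by have [->//|ii0] := eqVneq i i0; apply: H; rewrite !inE.
by move=> _; exact: H.
Qed.

(** * Polynomial expansion of the zero-sum indicator *)

(** Indexing by words [h] rather than by exponents avoids multinomial coefficients. *)
Lemma exprn_sum (R : comNzRingType) (J : finType) (z : J -> R) k :
  (\sum_j z j) ^+ k =
  \sum_(h : {ffun 'I_k -> J}) \prod_j z j ^+ #|[set t | h t == j]|.
Proof.
rewrite -[k in LHS]card_ord -prodr_const bigA_distr_bigA.
apply: eq_bigr => h _; rewrite (partition_big h predT) //=.
apply: eq_bigr => j _; rewrite -prodr_const.
by apply: eq_big => [t|t /eqP->//]; rewrite inE.
Qed.

(** By Fermat, [1 - z^(p-1)] is the indicator of [z = 0]; the product over the [n] coordinates is
    expanded. [u h j i] is the exponent of coordinate [i] of [y j]. *)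
Lemma zero_sum_expansion (p n m : nat) : prime p ->
  exists (Psi : finType) (c : Psi -> 'F_p) (u : Psi -> 'I_m -> 'I_n -> nat),
    (forall h i, (\sum_j u h j i <= p.-1)%N) /\
    forall y : 'I_m -> 'rV['F_p]_n,
      (\sum_j y j == 0)%:R
        = \sum_h c h * \prod_j \prod_i (y j 0 i) ^+ u h j i.
Proof.
move=> p_pr.
(* [inl tt] stands for the constant term 1, [inr h'] for a word of [-(sum)^(p-1)]. *)
pose P1 : finType := (unit + {ffun 'I_p.-1 -> 'I_m})%type.
pose c1 (h : P1) : 'F_p := if h is inl _ then 1 else -1.
pose u1 (h : P1) j := if h is inr h' then #|[set t | h' t == j]| else 0%N.
have E1 (z : 'I_m -> 'F_p) :
    (\sum_j z j == 0)%:R = \sum_h c1 h * \prod_j z j ^+ u1 h j.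
  rewrite big_sumType /= (big_pred1 tt) => [|[]//].
  rewrite [X in 1 * X]big1 ?mulr1 //.
  under [X in _ + X]eq_bigr do rewrite mulN1r.
  rewrite sumrN -exprn_sum.
  have [->|z0] := eqVneq (\sum_j z j) 0.
    by rewrite expr0n -subn1 subn_eq0 leqNgt prime_gt1 // subr0.
  have : (\sum_j z j) ^+ p.-1 = 1.
    apply: (mulfI z0); rewrite mulr1 -exprS prednK ?prime_gt0 //.
    by have := expf_card (\sum_j z j); rewrite card_Fp.
  by move=> ->; rewrite subrr.
exists {ffun 'I_n -> P1}, (fun h : {ffun 'I_n -> P1} => \prod_i c1 (h i)),
  (fun (h : {ffun 'I_n -> P1}) j i => u1 (h i) j).
split=> [h i|y].
  rewrite /u1; case: (h i) => [_|h']; first by rewrite big1.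
  rewrite -[leqRHS]card_ord -sum1_card (partition_big h' predT) //=.
  apply: leq_sum => j _; rewrite -sum1_card eq_leq //.
  by apply: eq_bigl => t; rewrite inE.
transitivity (\prod_i \sum_h c1 h * \prod_j (y j 0 i) ^+ u1 h j).
  under [RHS]eq_bigr do rewrite -E1.
  case: eqP => [/rowP y0|y0].
    by rewrite big1 // => i _; have := y0 i; rewrite summxE mxE => ->; rewrite eqxx.
  have [i yi] : exists i, \sum_j y j 0 i != 0.
    apply/existsP; apply: contra_notT y0 => /existsPn y0; apply/rowP => i.
    by rewrite summxE mxE; apply/eqP; rewrite -[_ == _]negbK.
  by rewrite (bigD1 i) //= (negbTE yi) mul0r.
rewrite bigA_distr_bigA; apply: eq_bigr => h _.
by rewrite big_split exchange_big.
Qed.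

(** * Admissible blocks and orbits of low degree *)

Lemma card_blocks (p : nat) : (1 < p)%N ->
  #|[set B : {set 'I_p} | (B != set0) && (1 < #|~: B|)%N]| = (2 ^ p - p - 2)%N.
Proof.
move=> p1; set Bs := [set _ | _].
have C : #|~: Bs| = p.+2.
  (* The excluded sets are the empty set, the full set and the [p] complements of singletons, all
     distinct as [p > 1]. *)
  have -> : ~: Bs = set0 |: (setT |: [set [set~ i] | i : 'I_p]).
    apply/setP => B; rewrite !inE negb_and negbK -leqNgt leq_eqVlt ltnS leqn0.
    congr (_ || _); rewrite orbC; congr (_ || _).
      by rewrite cards_eq0 -[B in RHS]setCK -finset.setC0 (inj_eq (@setC_inj _)).
    apply/cards1P/imsetP => [[i iB]|[i _ ->]]; exists i; rewrite ?setCK //.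
    by rewrite -iB setCK.
  rewrite !cardsU1 !inE negb_or card_imset ?card_ord; last first.
    by move=> i j /setC_inj/finset.set1_inj.
  have -> : set0 != setT :> {set 'I_p}.
    by rewrite eq_sym -card_gt0 cardsT card_ord ltnW.
  have nimT : setT \notin [set [set~ i] | i : 'I_p].
    by apply/imsetP => -[i _ /setP/(_ i)]; rewrite !inE eqxx.
  have nim0 : set0 \notin [set [set~ i] | i : 'I_p].
    apply/imsetP => -[i _ /(congr1 (fun B : {set _} => #|B|))].
    rewrite cards0 cardsC1 card_ord => /esym/eqP.
    by rewrite -subn1 subn_eq0 leqNgt p1.
  by rewrite nim0 nimT.
have := cardsC Bs; rewrite C -cardsT -powersetT card_powerset cardsT card_ord.
by move=> <-; rewrite -subnDA addn2 addnK.
Qed.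

Lemma mem_porbits (T : finType) (s : {perm T}) B j :
  B \in porbits s -> (porbit s j == B) = (j \in B).
Proof. by case/imsetP => i _ ->; rewrite eq_porbit_mem. Qed.

Lemma porbits_stable (T : finType) (s : {perm T}) B j :
  B \in porbits s -> (s j \in B) = (j \in B).
Proof. by move=> Bs; rewrite -!(mem_porbits _ Bs) -(porbit_perm s 1 j) expg1. Qed.

(** Exponents of the monomials in the coordinates of one vector with degree at most [n(p-1)/3]. *)
Definition low_degree (p n : nat) : {set {ffun 'I_n -> 'I_p}} :=
  [set e : {ffun 'I_n -> 'I_p} | (3 * \sum_i e i <= n * p.-1)%N].

(** The orbits partition [T], so the lightest of at least [k] orbits carries at most a [1/k] share
    of the weight. *)
Lemma small_porbit (T : finType) (s : {perm T}) k (d : T -> nat) :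
  (0 < k <= #|porbits s|)%N ->
  exists2 B, B \in porbits s & (k * \sum_(j in B) d j <= \sum_j d j)%N.
Proof.
move=> /andP[k0 ks]; set N := (\sum_j d j)%N.
have [B Bs BN] : exists2 B, B \in porbits s & (k * \sum_(j in B) d j <= N)%N.
  apply/exists_inP; apply: contraLR ks => /exists_inPn H; rewrite -ltnNge.
  have NE : N = (\sum_(B in porbits s) \sum_(j in B) d j)%N.
    rewrite [LHS](partition_big (porbit s) (mem (porbits s))) => [|j _]; last first.
      exact: imset_f.
    by apply: eq_bigr => B Bs; apply: eq_bigl => j; rewrite mem_porbits.
  have : (#|porbits s| * N.+1 <= k * N)%N.
    rewrite -sum_nat_const {2}NE big_distrr /=.
    by apply: leq_sum => B Bs; rewrite ltnNge H.
  rewrite ltnNge; apply: contraL => ks; rewrite -ltnNge.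
  by apply: (@leq_trans (k * N.+1)); rewrite ?ltn_pmul2l // leq_mul2r ks orbT.
by exists B.
Qed.

(** Each orbit other than [B] has a point outside [B]; with three orbits, [B] therefore misses two
    indices. *)
Lemma card_porbits_setC (T : finType) (s : {perm T}) (B : {set T}) :
  B \in porbits s -> (#|porbits s| <= #|~: B|.+1)%N.
Proof.
move=> Bs; rewrite (cardsD1 B) Bs add1n ltnS.
apply: leq_trans (leq_imset_card (porbit s) _).
apply/subset_leq_card/subsetP => C /setD1P[CB /imsetP[j _ CE]].
rewrite {}CE in CB *; by rewrite imset_f // inE -(mem_porbits _ Bs).
Qed.

(** * Sets without [p] distinct elements of sum zero *)

Lemma card_no_distinct_zero_sum (p n : nat) (X : finType) (v : X -> 'rV['F_p]_n) :
  prime p -> (2 < p)%N -> injective v ->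
  (forall x : {ffun 'I_p -> X}, injective x -> \sum_i v (x i) != 0) ->
  (#|X| <= (2 ^ p - p - 2) * #|low_degree p n|)%N.
Proof.
move=> p_pr p_gt2 v_inj no_zero.
have p_gt0 : (0 < p)%N := prime_gt0 p_pr.
pose i0 := Ordinal p_gt0.
have [Psi [c [u [u_le cE]]]] := zero_sum_expansion n p p_pr.
set E := low_degree p n.
pose few (s : 'S_p) := (#|porbits s| <= 2)%N.
pose K : 'F_p := \sum_(s | few s) (-1) ^+ s.
pose inv (s : 'S_p) (x : {ffun 'I_p -> X}) := [forall i, x (s i) == x i].
(* The full signed sum vanishes by [no_zero], so the terms with many orbits are opposite to those
   with few, which sum to [K] times the diagonal. *)
have diagE (x : {ffun 'I_p -> X}) :
    \sum_(s | ~~ few s) (-1) ^+ s *+ inv s x * (\sum_i v (x i) == 0)%:R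
      = - K *+ [forall i, x i == x i0] :> 'F_p.
  set z : 'F_p := (_ == 0)%:R; set cst := [forall i, _].
  have few_term s : few s -> (-1) ^+ s *+ inv s x * z = (-1) ^+ s *+ cst :> 'F_p.
    move=> s2; rewrite -mulr_natr -mulrA -[RHS]mulr_natr; congr (_ * _).
    rewrite -natrM mulnb; congr (nat_of_bool _)%:R.
    apply/andP/forallP => [[/forallP xs /eqP x0] i|xc].
      apply/eqP/v_inj; apply: (few_porbits_const p_pr s2 _ x0) => j.
      by rewrite (eqP (xs j)).
    split; first by apply/forallP => i; rewrite !(eqP (xc _)).
    rewrite (eq_bigr (fun=> v (x i0))) => [|i _]; last by rewrite (eqP (xc i)).
    rewrite sumr_const card_ord -scaler_nat (pcharf0 (pchar_Fp p_pr)).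
    by rewrite scale0r.
  have := congr1 ( *%R^~ z) (sum_sign_stable 'F_p x); rewrite mulr_suml.
  have -> : (injectiveb x)%:R * z = 0.
    case: injectiveP => [/no_zero x0|_]; rewrite ?mul0r //.
    by rewrite /z (negbTE x0) mulr0.
  rewrite (bigID few) /= (eq_bigr _ few_term) sumrMnl -/K => /eqP.
  by rewrite addrC addr_eq0 mulNrn => /eqP.
pose deg h (B : {set 'I_p}) := (\sum_(j in B) \sum_i u h j i)%N.
(* The default [finset.set0] is never reached when [s] has at least three orbits. *)
pose blk (s : 'S_p) h := odflt finset.set0
  [pick B in porbits s | (3 * deg h B <= n * p.-1)%N].
have blkP s h : ~~ few s ->
    blk s h \in porbits s /\ (3 * deg h (blk s h) <= n * p.-1)%N.
  rewrite -ltnNge => s3; rewrite /blk; case: pickP => [B /andP[]//|nB].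
  have [B Bs le_B] := @small_porbit _ s 3 (fun j => \sum_i u h j i)%N s3.
  have /= := nB B; rewrite Bs (leq_trans le_B) // exchange_big /=.
  by rewrite -[X in (X * _)%N](card_ord n) -sum_nat_const leq_sum.
have lt_p h (B : {set 'I_p}) i : (\sum_(j in B) u h j i < p)%N.
  rewrite -[ltnRHS](prednK p_gt0) ltnS (leq_trans _ (u_le h i)) //.
  by rewrite [leqRHS](bigID (mem B)) leq_addr.
pose ex h B := [ffun i => Ordinal (lt_p h B i)] : {ffun 'I_n -> 'I_p}.
pose D := setX [set B : {set 'I_p} | (B != finset.set0) && (1 < #|~: B|)%N] E.
(* The pairs (permutation, monomial) with the same block and the same exponents
   on it are collected into a single product f t * g t. *)
pose key (sh : 'S_p * Psi) := (blk sh.1 sh.2, ex sh.2 (blk sh.1 sh.2)).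
have keyD sh : ~~ few sh.1 -> key sh \in D.
  case: sh => s h /= s3; have [Bs le_B] := blkP s h s3.
  rewrite in_setX /E /low_degree !inE /=; apply/andP; split.
    apply/andP; split.
      by case/imsetP: Bs => i _ ->; apply/finset.set0Pn; exists i; exact: porbit_id.
    by rewrite -ltnS (leq_trans _ (card_porbits_setC Bs)) // ltnNge.
  apply: leq_trans le_B; rewrite leq_mul2l /deg exchange_big /=.
  by apply: leq_sum => i _; rewrite ffunE.
pose rep (B : {set 'I_p}) := odflt i0 [pick j in B].
have repP B : B != finset.set0 -> rep B \in B.
  rewrite /rep => /finset.set0Pn[j jB]; by case: pickP => [//|/(_ j)]; rewrite jB.
(* Where the indicator is 1, all variables of the block agree, so its monomial involves only the
   vector of the representative. *)
pose f (t : {set 'I_p} * {ffun 'I_n -> 'I_p}) (x : {ffun 'I_p -> X}) : 'F_p :=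
  [forall j in t.1, x j == x (rep t.1)]%:R
    * \prod_i (v (x (rep t.1)) 0 i) ^+ t.2 i.
pose rest (s : 'S_p) h B (x : {ffun 'I_p -> X}) : 'F_p :=
  (-1) ^+ s * c h * ([forall j in ~: B, x (s j) == x j]%:R
    * \prod_(j in ~: B) \prod_i (v (x j) 0 i) ^+ u h j i).
pose g (t : {set 'I_p} * {ffun 'I_n -> 'I_p}) (x : {ffun 'I_p -> X}) : 'F_p :=
  \sum_(sh | ~~ few sh.1 && (key sh == t)) rest sh.1 sh.2 t.1 x.
have fgE s h x : ~~ few s ->
    f (key (s, h)) x * rest s h (blk s h) x =
    (-1) ^+ s *+ inv s x * (c h * \prod_j \prod_i (v (x j) 0 i) ^+ u h j i).
  move=> s3; have [Bs _] := blkP s h s3; rewrite /f /rest /key /=.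
  set B := blk s h in Bs *; set r := rep B.
  have rB : r \in B.
    apply: repP; case/imsetP: Bs => j _ BE; apply/finset.set0Pn.
    by exists j; rewrite BE porbit_id.
  have -> : inv s x = [forall j in B, x j == x r]
                      && [forall j in ~: B, x (s j) == x j].
    (* The orbit [B] is stable under [s], so invariance of [x] splits into constancy on [B] and
       invariance on its complement. *)
    apply/forallP/andP => [xs|[/forall_inP xB /forall_inP xC] j].
      split; apply/forall_inP => j jB; last exact: xs.
      have := jB; rewrite -(mem_porbits _ Bs) => /eqP BE.
      move: rB; rewrite -BE porbit_sym => /porbitP[k ->].
      by elim: k => [|k /eqP<-]; rewrite ?perm1 // expgSr permM xs.
    have [jB|jB] := boolP (j \in B); last by rewrite xC // inE.
    have sjB : s j \in B by rewrite (porbits_stable _ Bs).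
    by rewrite (eqP (xB _ sjB)) (eqP (xB _ jB)).
  rewrite -mulnb -[_ *+ (_ * _)%N]mulr_natr natrM.
  case: forall_inP => [xB|_]; last by rewrite !(mul0r, mulr0).
  rewrite [in RHS](bigID (mem B)) /= [X in _ = _ * (_ * (X * _))](_ : _ =
    \prod_i (v (x r) 0 i) ^+ ex h B i); last first.
    rewrite exchange_big; apply: eq_bigr => i _ /=; rewrite ffunE /= expr_sum.
    by apply: eq_bigr => j jB; rewrite (eqP (xB j jB)).
  rewrite [X in _ = _ * (_ * (_ * X))](eq_bigl (mem (~: B))) => [|j]; last first.
    by rewrite !inE.
  by rewrite !mul1r [RHS]mulrACA [in RHS](mulrCA _%:R) mulrCA.
(* The diagonal coefficient is the nonzero constant [- K], so every element of [X] is counted. *)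
suff : (#|[set a : X | (fun=> - K) a != 0%R]| <= #|D|)%N.
  rewrite (_ : [set _ | _] = [set: X]); last first.
    apply/setP => a; rewrite !inE oppr_eq0.
    exact: sum_sign_few_porbits_neq0.
  by rewrite cardsT cardsX card_blocks // (ltn_trans _ p_gt2).
apply: (partition_rank_diag (i0 := i0) (B := fun t => t.1) (f := f) (g := g)).
- case=> B e; rewrite in_setX inE /= => /andP[/andP[-> B1] _]; split=> //.
  by rewrite -card_gt0 (leq_trans _ B1).
- case=> B e; rewrite in_setX inE /= => /andP[/andP[B0 _] _] x y xy.
  rewrite /f /= (xy _ (repP _ B0)); congr (_%:R * _).
  congr nat_of_bool; apply/forall_inP/forall_inP => H j jB;
  by move: (H j jB); rewrite xy.
- case=> B e _ x y xy; apply: eq_bigr => -[s h] /= /andP[s3 /eqP[BE _]].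
  have sB j : j \in ~: B -> s j \in ~: B.
    have [Bs _] := blkP s h s3; rewrite BE in Bs.
    by rewrite !inE (porbits_stable _ Bs).
  rewrite /rest; congr (_ * (_%:R * _)).
    congr nat_of_bool; apply/forall_inP/forall_inP => H j jB; move: (H j jB);
    by rewrite !xy // sB.
  by apply: eq_bigr => j jB; rewrite xy.
move=> x; rewrite -diagE.
under [RHS]eq_bigr do rewrite cE big_distrr /=.
rewrite pair_big_dep /= (partition_big key (mem D)) /=; last first.
  by move=> sh; rewrite andbT; exact: keyD.
apply: eq_bigr => t tD; rewrite /g big_distrr /=.
apply: eq_big => [[s h]|[s h] /andP[s3 /eqP<-]]; first by rewrite andbT.
exact: fgE.
Qed.

(** * Counting monomials of low degree *)

(** Expand [(1 + c + ... + c^(p-1))^n] as the sum of [c^(e_1 + ... + e_n)] over all exponent vectors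
    [e]. As [c < 1], each vector of low degree contributes at least [c^(n(p-1)/3)]. *)
Lemma card_low_degree (R : realType) (p n : nat) (c : R) : (0 < p)%N -> 0 < c < 1 ->
  #|low_degree p n|%:R
    <= Jfun p c ^+ n.
Proof.
move=> p0 /andP[c0 c1]; set E := low_degree p n; pose a : R := (p%:R - 1) / 3.
have -> : Jfun p c = (\sum_(i < p) c ^+ i) * c `^ (- a).
  rewrite /Jfun; congr (_ * _).
  by rewrite -opprB subrX1 -mulNr opprB mulrAC divff ?mul1r // subr_eq0 gt_eqF.
rewrite exprMn -[in X in _ <= X * _](card_ord n) -prodr_const bigA_distr_bigA /=.
rewrite powRN exprVn ler_pdivlMr ?exprn_gt0 ?powR_gt0 //.
rewrite -powR_mulrn ?powR_ge0 // -powRrM -sumr_const mulr_suml.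
rewrite [leRHS](bigID (mem E)) /= -[leLHS]addr0 lerD //; last first.
  by apply: sumr_ge0 => e _; apply: prodr_ge0 => i _; rewrite exprn_ge0 // ltW.
apply: ler_sum => e; rewrite /E /low_degree inE => eE.
rewrite mul1r prodrXr -powR_mulrn ?(ltW c0) // ger_powR ?c0 ?(ltW c1) //.
have pE : p%:R = p.-1%:R + 1 :> R by rewrite natr1 prednK.
move: eE; rewrite -(ler_nat R) !natrM /a pE; lra.
Qed.

(** * Bounds for subsets and for the Erdos-Ginzburg-Ziv constant *)

Lemma card_no_distinct_zero_sum_set (p n : nat) (A : {set 'rV['F_p]_n}) :
  prime p -> (2 < p)%N ->
  ~ (exists x : 'I_p -> 'rV['F_p]_n,
       [/\ injective x, (forall i, x i \in A) & \sum_i x i = 0]) ->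
  (#|A| <= (2 ^ p - p - 2) * #|low_degree p n|)%N.
Proof.
move=> p_pr p_gt2 noA.
rewrite -(card_sig (mem A)).
apply: (@card_no_distinct_zero_sum _ _ _ val) => // x x_inj.
apply/eqP => x0; apply: noA; exists (fun i => val (x i)); split=> //.
  by move=> i j /val_inj/x_inj.
by move=> i; exact: (valP (x i)).
Qed.

Lemma exponent_rV (p n : nat) : prime p -> (0 < n)%N ->
  exponent [set: 'rV['F_p]_n] = p.
Proof.
move=> p_pr n0; apply/eqP.
have : (exponent [set: 'rV['F_p]_n] %| p)%N.
  apply/exponentP => x _; rewrite FinRing.zmodXgE -scaler_nat.
  by rewrite (pcharf0 (pchar_Fp p_pr)) scale0r.
have /primeP[_ dvd_p] := p_pr; case/dvd_p/orP => // /eqP e1.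
have := expg_exponent (finset.in_setT (const_mx 1 : 'rV['F_p]_n)).
rewrite e1 expg1 => /rowP/(_ (Ordinal n0)); rewrite !mxE => /eqP.
by rewrite oner_eq0.
Qed.

(** Either some value occurs [p] times and its copies sum to zero, or [(p-1)M + 1] terms have more
    than [M] distinct values. *)
Lemma erdos_ginzburg_ziv_le (p n M : nat) : prime p -> (0 < n)%N ->
  (forall A : {set 'rV['F_p]_n}, ~ (exists x : 'I_p -> 'rV['F_p]_n,
       [/\ injective x, (forall i, x i \in A) & \sum_i x i = 0]) ->
     (#|A| <= M)%N) ->
  (erdos_ginzburg_ziv 'rV['F_p]_n <= (p.-1 * M).+1)%N.
Proof.
move=> p_pr n0 le_M.
rewrite /erdos_ginzburg_ziv; case: ex_minnP => m _; apply.
apply/forallP => s; rewrite exponent_rV //.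
have p0 := prime_gt0 p_pr.
have [/existsP[g le_g]|/existsPn few] := boolP [exists g, p <= count_mem g s]%N.
  apply/existsP; exists (nseq_tuple p g); apply/andP; split.
    apply: (@subseq_trans _ (nseq (count_mem g s) g)).
      by rewrite -(subnKC le_g) nseqD prefix_subseq.
    have <- : seq.filter (pred1 g) s = nseq (count_mem g s) g.
      by rewrite -size_filter; apply/all_pred1P/filter_all.
    exact: filter_subseq.
  rewrite /= big_nseq iter_addr_0 -scaler_nat.
  by rewrite (pcharf0 (pchar_Fp p_pr)) scale0r.
pose A := [set x in s].
have lt_A : (M < #|A|)%N.
  have : (size s <= p.-1 * #|A|)%N.
    rewrite [leqRHS]mulnC -sum_nat_const -sum1_size.
    rewrite big_tnth (partition_big (tnth (in_tuple s)) (mem A)) /=.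
      apply: leq_sum => g _; have := few g.
      rewrite -ltnNge -[p in (_ < p)%N]prednK // ltnS.
      by apply: leq_trans; rewrite -sum1_count [leqRHS]big_tnth.
    by move=> i _; rewrite inE mem_tnth.
  rewrite size_tuple; by rewrite ltn_pmul2l // -ltnS prednK // prime_gt1.
have [x [x_inj xA x0]] : exists x : 'I_p -> 'rV['F_p]_n,
    [/\ injective x, (forall i, x i \in A) & \sum_i x i = 0].
  by apply: contrapT => /le_M; rewrite leqNgt lt_A.
(* The values of [x] are listed in the order of [s], to form a subsequence. *)
pose t := [seq y <- undup s | y \in codom x].
have tx : perm_eq t (codom x).
  apply: uniq_perm; first by rewrite filter_uniq ?undup_uniq.
    by rewrite map_inj_uniq ?enum_uniq.
  move=> y; rewrite mem_filter mem_undup andb_idr // => /codomP[i ->].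
  by have := xA i; rewrite inE.
have st : size t == p by rewrite (perm_size tx) size_codom card_ord.
apply/existsP; exists (Tuple st); apply/andP; split => /=.
  exact: subseq_trans (filter_subseq _ _) (undup_subseq _).
by rewrite (perm_big _ tx) big_image /= x0.
Qed.

Theorem theorem1 (R : realType) (p n : nat) (p_prime : prime p)
    (p_gt2 : (2 < p)%N) (n_gt0 : (0 < n)%N) :
  (forall A : {set 'rV['F_p]_n},
     ~ (exists x : 'I_p -> 'rV['F_p]_n,
          [/\ injective x, (forall i, x i \in A) & \sum_i x i = 0]) ->
     #|A|%:R <= (2 ^+ p - p%:R - 2) * (p%:R * J R p) ^+ n)
  /\ (erdos_ginzburg_ziv 'rV['F_p]_n)%:R
       <= (p%:R - 1) * 2 ^+ p * (p%:R * J R p) ^+ n.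
Proof.
have p_gt0 : (0 < p)%N := prime_gt0 p_prime.
have [c c01 minc] := Jfun_min R p_gt2.
rewrite (JE c01 minc) mulrA divff ?pnatr_eq0 -?lt0n // mul1r.
have := card_low_degree n p_gt0 c01; set E := low_degree p n => cardE.
(* This keeps the subtraction in [nat] from truncating. *)
have pow_p : (p + 2 < 2 ^ p)%N.
  rewrite -(subnKC p_gt2) !addSn add0n; elim: (p - 3)%N => // k IH.
  by rewrite expnS; lia.
have blocksE : (2 ^ p - p - 2)%N%:R = 2 ^+ p - p%:R - 2 :> R.
  rewrite -subnDA natrB; last exact: ltnW.
  by rewrite natrX natrD opprD addrA.
split=> [A noA|].
  have le_A := card_no_distinct_zero_sum_set p_prime p_gt2 noA.
  apply: (@le_trans _ _ ((2 ^ p - p - 2) * #|E|)%N%:R); first by rewrite ler_nat.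
  by rewrite natrM -blocksE; apply: ler_wpM2l cardE; exact: ler0n.
(* With [E] nonempty, passing from [2 ^ p - p - 2] to [2 ^ p] absorbs the final [+1]. *)
have E_gt0 : (0 < #|E|)%N.
  apply/card_gt0P; exists [ffun=> Ordinal p_gt0].
  by rewrite /E /low_degree inE big1 ?muln0 // => i _; rewrite ffunE.
have := erdos_ginzburg_ziv_le p_prime n_gt0
  (fun A => @card_no_distinct_zero_sum_set p n A p_prime p_gt2).
rewrite -/E => egz.
have {egz} : (erdos_ginzburg_ziv 'rV['F_p]_n <= p.-1 * 2 ^ p * #|E|)%N.
  apply: leq_trans egz _; rewrite -mulnA.
  have p1 : (0 < p.-1)%N by rewrite -subn1 subn_gt0 prime_gt1.
  have sub2 : ((2 ^ p - p - 2) * #|E| < 2 ^ p * #|E|)%N.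
    by rewrite ltn_pmul2r // -subnDA ltn_subrL addn2 expn_gt0.
  by apply: leq_trans (leq_mul (leqnn p.-1) sub2); rewrite mulnS -addn1 addnC leq_add2r.
rewrite -(ler_nat R) !natrM natrX => /le_trans; apply.
have -> : p%:R - 1 = p.-1%:R :> R by rewrite -subn1 natrB.
by apply: ler_wpM2l cardE; rewrite mulr_ge0 ?exprn_ge0.
Qed.
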